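(* Let $n\ge 5$ and let $\ell$ be a cyclic length metric on $\partial C(n,4)$. Then $\ell$ is both $\mathcal{LCSC}$ and $\mathcal{VCSC}$; that is, for every vertex $v\in V$, $$K_v=\lambda_{\mathcal L}\,L_v\quad\text{with}\quad \lambda_{\mathcal L}=\frac{\mathcal{EHR}}{\mathcal L},\qquad\text{and}\qquad K_v=\lambda_{\mathcal V}\,V_v\quad\text{with}\quad \lambda_{\mathcal V}=\frac{\mathcal{EHR}}{3\mathcal V}.$$
   Context: Let $x(t)=(t,t^2,t^3,t^4)\in\mathbb R^4$ and $t_1<\dots<t_n$ with $n\ge5$. The cyclic polytope $C(n,4)$ is the convex hull of $V=\{v_1,\dots,v_n\}$, $v_i=x(t_i)$. $\partial C(n,4)$ denotes its boundary complex, a simplicial triangulation of $\mathbb S^3$ with vertex set $V$, edge set $E$, set of 2-faces (triangles) $F$ and set of tetrahedra $T$. It is well known to be neighborly: every pair $v_i\ne v_j$ spans an edge $e_{ij}\in E$. The distinguished cycle is $\mathcal C=\{v_iv_{i+1}:1\le i<n\}\cup\{v_nv_1\}$, and $D_{ij}$ is the minimum number of edges of $\mathcal C$ in a path in $\mathcal C$ from $v_i$ to $v_j$. A metric is an assignment of lengths $\ell_e>0$ to the edges $e\in E$ such that every simplex of the triangulation can be realized as a (nondegenerate) Euclidean simplex with these edge lengths. It is a cyclic length metric if $\ell(e_{ij})$ depends only on $D_{ij}$. Write $\tau<\sigma$ (or $\sigma>\tau$) if $\tau$ is a sub-simplex of $\sigma$. For a metric $\ell$, let $\beta_{e<t}$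 be the dihedral angle of the Euclidean tetrahedron $t$ at its edge $e$. Define: - edge curvature: $K_e=\bigl(2\pi-\sum_{t>e}\beta_{e<t}\bigr)\ell_e$; - vertex curvature: $K_v=\frac12\sum_{e>v}K_e$; - $\mathcal{EHR}=\sum_{v\in V}K_v$; - total length $\mathcal L=\sum_{e\in E}\ell_e$, and $L_v=\frac12\sum_{e>v}\ell_e$; - total volume $\mathcal V=\sum_{t\in T}\mathrm{Vol}(t)$, and $V_v=\frac13\sum_{t>f>v}h_{f<t}A_f$, where the sum is over all pairs (tetrahedron $t$, triangle $f$) with $v<f<t$, $A_f$ is the area of $f$, and $h_{f<t}$ is the signed distance between the circumcenter of $f$ and the circumcenter of $t$, taken positive if the circumcenter of $t$ lies on the same side of the plane of $f$ as $t$, and negative if it lies on the other side. *)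

(* Defs.v *)
From HB Require Import structures.
From mathcomp Require Import all_boot all_order all_algebra.
From mathcomp Require Import all_classical all_reals all_analysis.

Set Implicit Arguments.
Unset Strict Implicit.
Unset Printing Implicit Defensive.

Import Order.TTheory GRing.Theory Num.Theory.

Local Open Scope classical_set_scope.
Local Open Scope ring_scope.

(** * Elementary Euclidean geometry *)

(* The library norm [`|u|] on matrices is the sup norm, hence [enorm]. *)
Definition dot (R : realType) (d : nat) (u v : 'rV[R]_d) : R :=
  \sum_(k < d) u 0 k * v 0 k.

Definition enorm (R : realType) (d : nat) (u : 'rV[R]_d) : R :=
  Num.sqrt (dot u u).

(* Component of [u] orthogonal to [w]. *)
Definition reject (R : realType) (d : nat) (u w : 'rV[R]_d) : 'rV[R]_d :=
  u - (dot u w / dot w w) *: w.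

Definition angle (R : realType) (d : nat) (u v : 'rV[R]_d) : R :=
  acos (dot u v / (enorm u * enorm v)).

Definition convex_hull (R : realType) (n d : nat) (p : 'I_n -> 'rV[R]_d) :
    set 'rV[R]_d :=
  [set x | exists w : 'I_n -> R,
     [/\ forall i, 0 <= w i, \sum_i w i = 1 & x = \sum_i w i *: p i]].

Definition affine_hull (R : realType) (n d : nat) (p : 'I_n -> 'rV[R]_d)
    (s : {set 'I_n}) : set 'rV[R]_d :=
  [set x | exists w : 'I_n -> R,
     \sum_(i in s) w i = 1 /\ x = \sum_(i in s) w i *: p i].

Definition affinely_independent (R : realType) (n d : nat)
    (p : 'I_n -> 'rV[R]_d) (s : {set 'I_n}) : Prop :=
  forall w : 'I_n -> R,
    \sum_(i in s) w i = 0 -> \sum_(i in s) w i *: p i = 0 ->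
    forall i, i \in s -> w i = 0.

(* Faces of a polytope: intersections with supporting hyperplanes
   (degenerate functionals give the improper faces [set0] and [P]). *)
Definition is_face (R : realType) (d : nat) (P F : set 'rV[R]_d) : Prop :=
  exists (a : 'rV[R]_d) (b : R),
    (forall x, P x -> dot a x <= b) /\ F = P `&` [set x | dot a x = b].

(** * The cyclic polytope and its boundary complex *)

Definition moment_curve (R : realType) (s : R) : 'rV[R]_4 :=
  \row_(k < 4) s ^+ k.+1.

Definition cyclic_polytope (R : realType) (n : nat) (t : 'I_n -> R) :
    set 'rV[R]_4 :=
  convex_hull (fun i => moment_curve (t i)).

(* Each nonempty proper face is recorded by the indices of the vertices
   lying on it. *)
Definition boundary_complex (R : realType) (n : nat) (t : 'I_n -> R) :
    {set {set 'I_n}} :=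
  [set s : {set 'I_n} | `[< exists F : set 'rV[R]_4,
     [/\ is_face (cyclic_polytope t) F, F !=set0, F <> cyclic_polytope t
       & forall i, (i \in s) <-> F (moment_curve (t i))] >]]%SET.

Definition edges (R : realType) (n : nat) (t : 'I_n -> R) : {set {set 'I_n}} :=
  [set s in boundary_complex t | #|s| == 2]%SET.

Definition triangles (R : realType) (n : nat) (t : 'I_n -> R) :
    {set {set 'I_n}} :=
  [set s in boundary_complex t | #|s| == 3]%SET.

Definition tetrahedra (R : realType) (n : nat) (t : 'I_n -> R) :
    {set {set 'I_n}} :=
  [set s in boundary_complex t | #|s| == 4]%SET.

(* [ordS] is the successor modulo [n]. *)
Definition cycle_adj (n : nat) : rel 'I_n :=
  fun i j => (j == ordS i) || (i == ordS j).

(* Least number of edges of a path from [i] to [j] in the cycle. *)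
Definition cycle_dist (n : nat) (i j : 'I_n) : nat :=
  find (fun k => [exists p : k.-tuple 'I_n,
                    path (@cycle_adj n) i p && (last i p == j)]) (iota 0 n).

(** * Metrics *)

(* A length assignment is a total function on vertex sets; only its values on
   the edges matter. *)
Definition realizes (R : realType) (n : nat) (l : {set 'I_n} -> R)
    (s : {set 'I_n}) (p : 'I_n -> 'rV[R]_3) : Prop :=
  affinely_independent p s /\
  forall i j, i \in s -> j \in s -> i != j ->
    enorm (p i - p j) = l [set i; j]%SET.

Definition is_metric (R : realType) (n : nat) (t : 'I_n -> R)
    (l : {set 'I_n} -> R) : Prop :=
  (forall e, e \in edges t -> 0 < l e) /\
  (forall s, s \in boundary_complex t -> exists p, realizes l s p).

Definition is_cyclic_length_metric (R : realType) (n : nat) (t : 'I_n -> R)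
    (l : {set 'I_n} -> R) : Prop :=
  is_metric t l /\
  forall i j i' j' : 'I_n,
    [set i; j]%SET \in edges t -> [set i'; j']%SET \in edges t ->
    cycle_dist i j = cycle_dist i' j' ->
    l [set i; j]%SET = l [set i'; j']%SET.

(** * Euclidean quantities of a simplex *)

(* A chosen realization, unique up to isometry; every quantity computed from
   it below is isometry invariant. *)
Definition realization (R : realType) (n : nat) (l : {set 'I_n} -> R)
    (s : {set 'I_n}) : 'I_n -> 'rV[R]_3 :=
  xget (fun=> 0) [set p | realizes l s p].

Definition vertices (R : realType) (n : nat) (p : 'I_n -> 'rV[R]_3)
    (s : {set 'I_n}) : seq 'rV[R]_3 :=
  [seq p i | i <- enum s].

(* Six times the signed volume of the tetrahedron [a b c x]; as a function of
   [x], its sign distinguishes the two sides of the plane [a b c]. *)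
Definition orient (R : realType) (a b c x : 'rV[R]_3) : R :=
  \det (\matrix_(i < 3) [:: b - a; c - a; x - a]`_i).

Definition tetra_volume (R : realType) (n : nat) (l : {set 'I_n} -> R)
    (s : {set 'I_n}) : R :=
  let P := vertices (realization l s) s in
  `|orient P`_0 P`_1 P`_2 P`_3| / 6.

(* Half of base times height. *)
Definition triangle_area (R : realType) (n : nat) (l : {set 'I_n} -> R)
    (f : {set 'I_n}) : R :=
  let P := vertices (realization l f) f in
  enorm (P`_1 - P`_0) * enorm (reject (P`_2 - P`_0) (P`_1 - P`_0)) / 2.

(* Angle between the two faces of [s] containing [e], measured in the plane
   orthogonal to [e]; [Q] lists the two vertices of [s] not on [e]. *)
Definition dihedral_angle (R : realType) (n : nat) (l : {set 'I_n} -> R)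
    (e s : {set 'I_n}) : R :=
  let P := vertices (realization l s) e in
  let Q := vertices (realization l s) (s :\: e)%SET in
  angle (reject (Q`_0 - P`_0) (P`_1 - P`_0))
        (reject (Q`_1 - P`_0) (P`_1 - P`_0)).

Definition circumcenter (R : realType) (n : nat) (p : 'I_n -> 'rV[R]_3)
    (s : {set 'I_n}) : 'rV[R]_3 :=
  xget 0 [set c | affine_hull p s c /\
     forall i j, i \in s -> j \in s -> enorm (c - p i) = enorm (c - p j)].

(* If the circumcenter of [s] lies in the plane of [f], it is the circumcenter
   of [f], so the value there is 0 and no sign choice is involved. *)
Definition signed_height (R : realType) (n : nat) (l : {set 'I_n} -> R)
    (f s : {set 'I_n}) : R :=
  let p := realization l s in
  let P := vertices p f in
  let side x := Num.sg (orient P`_0 P`_1 P`_2 x) in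
  let opposite := (vertices p (s :\: f)%SET)`_0 in
  let d := enorm (circumcenter p f - circumcenter p s) in
  if side (circumcenter p s) == side opposite then d else - d.

(** * Curvatures, total length and total volume *)

Definition edge_curvature (R : realType) (n : nat) (t : 'I_n -> R)
    (l : {set 'I_n} -> R) (e : {set 'I_n}) : R :=
  (2 * pi - \sum_(s in tetrahedra t | e \subset s) dihedral_angle l e s) * l e.

Definition vertex_curvature (R : realType) (n : nat) (t : 'I_n -> R)
    (l : {set 'I_n} -> R) (v : 'I_n) : R :=
  2^-1 * \sum_(e in edges t | v \in e) edge_curvature t l e.

Definition EHR (R : realType) (n : nat) (t : 'I_n -> R)
    (l : {set 'I_n} -> R) : R :=
  \sum_(v < n) vertex_curvature t l v.

Definition total_length (R : realType) (n : nat) (t : 'I_n -> R)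
    (l : {set 'I_n} -> R) : R :=
  \sum_(e in edges t) l e.

Definition vertex_length (R : realType) (n : nat) (t : 'I_n -> R)
    (l : {set 'I_n} -> R) (v : 'I_n) : R :=
  2^-1 * \sum_(e in edges t | v \in e) l e.

Definition total_volume (R : realType) (n : nat) (t : 'I_n -> R)
    (l : {set 'I_n} -> R) : R :=
  \sum_(s in tetrahedra t) tetra_volume l s.

Definition vertex_volume (R : realType) (n : nat) (t : 'I_n -> R)
    (l : {set 'I_n} -> R) (v : 'I_n) : R :=
  3^-1 * \sum_(s in tetrahedra t)
           \sum_(f in triangles t | (v \in f) && (f \subset s))
             signed_height l f s * triangle_area l f.

Definition is_LCSC (R : realType) (n : nat) (t : 'I_n -> R)
    (l : {set 'I_n} -> R) : Prop :=
  forall v, vertex_curvature t l v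
            = EHR t l / total_length t l * vertex_length t l v.

Definition is_VCSC (R : realType) (n : nat) (t : 'I_n -> R)
    (l : {set 'I_n} -> R) : Prop :=
  forall v, vertex_curvature t l v
            = EHR t l / (3 * total_volume t l) * vertex_volume t l v.

(* Main.v *)
From HB Require Import structures.
Require Import Defs.
From mathcomp Require Import all_boot all_order all_algebra.
From mathcomp Require Import all_classical all_reals all_analysis.
From mathcomp Require Import ring lra zify.
Import Order.TTheory GRing.Theory Num.Theory.
Local Open Scope ring_scope.

Set Implicit Arguments.
Unset Strict Implicit.
Unset Printing Implicit Defensive.

(** By Gale's evenness condition the facets of C(n,4) are the disjoint unions
    of two edges of the distinguished cycle, so the rotation v_i -> v_(i+1) is
    an automorphism of the boundary complex. A cyclic length metric is
    invariant under it, hence K_v, L_v and V_v do not depend on v, and the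
    constant ratios are found by summing over v. For L_v the sum is the total
    length. For V_v it is three times the total volume: writing the
    circumcenter of a tetrahedron t in barycentric coordinates w, the face
    opposite to the vertex x satisfies h A = 3 Vol(t) w_x, and the w_x add up
    to 1. *)

(** * Euclidean geometry *)

(** The obstacle is that every metric quantity is computed from a realization picked by choice,
    separately for each simplex, with vertices listed in the order of [enum], which the rotation
    does not respect. The realizations used for a tetrahedron, for its triangles and for its rotated
    copy are thus unrelated. Instead of building isometries between them, the proof expresses
    volumes, areas, dihedral angles and circumcentric weights through squared edge lengths, on which
    a relabelling acts visibly. Signed heights are never compared alone: only the product h A is, so
    that all sign conventions are settled once. Positivity of the total length and the total volume
    is established as well, because the constants are quotients by them. *)

Section Dot.
Variables (R : realType) (d : nat).
Implicit Types (u v w : 'rV[R]_d) (a : R).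

Lemma dotC u v : dot u v = dot v u.
Proof. by apply: eq_bigr => k _; rewrite mulrC. Qed.

Lemma dotDl u v w : dot (u + v) w = dot u w + dot v w.
Proof. by rewrite -big_split; apply: eq_bigr => k _; rewrite mxE mulrDl. Qed.

Lemma dotZl a u v : dot (a *: u) v = a * dot u v.
Proof. by rewrite mulr_sumr; apply: eq_bigr => k _; rewrite mxE mulrA. Qed.

Lemma dotNl u v : dot (- u) v = - dot u v.
Proof. by rewrite -scaleN1r dotZl mulN1r. Qed.

Lemma dotBl u v w : dot (u - v) w = dot u w - dot v w.
Proof. by rewrite dotDl dotNl. Qed.

Lemma dotZr a u v : dot v (a *: u) = a * dot v u.
Proof. by rewrite dotC dotZl dotC. Qed.

Lemma dotBr u v w : dot w (u - v) = dot w u - dot w v.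
Proof. by rewrite dotC dotBl !(dotC w). Qed.

Lemma dot0l u : dot 0 u = 0.
Proof. by rewrite -(scale0r 0) dotZl mul0r. Qed.

Lemma dot_suml (I : finType) (P : pred I) (F : I -> 'rV[R]_d) v :
  dot (\sum_(i | P i) F i) v = \sum_(i | P i) dot (F i) v.
Proof. by apply: (big_morph (fun u => dot u v)) => [u w|]; rewrite ?dotDl ?dot0l. Qed.

Lemma dot_ge0 u : 0 <= dot u u.
Proof. by apply: sumr_ge0 => k _; rewrite -expr2 sqr_ge0. Qed.

Lemma dot_eq0 u : (dot u u == 0) = (u == 0).
Proof.
apply/eqP/eqP => [|->]; last exact: dot0l.
move/psumr_eq0P => u0; apply/rowP => k; rewrite mxE.
by apply/eqP; rewrite -sqrf_eq0 expr2 u0 // => i _; rewrite -expr2 sqr_ge0.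
Qed.

Lemma dot_polar u v :
  dot u v = (dot u u + dot v v - dot (u - v) (u - v)) / 2.
Proof. by rewrite dotBl !dotBr (dotC v u); field. Qed.

Lemma sqr_enorm u : enorm u ^+ 2 = dot u u.
Proof. by rewrite sqr_sqrtr ?dot_ge0. Qed.

Lemma dot_distC u v : dot (u - v) (u - v) = dot (v - u) (v - u).
Proof. by rewrite -opprB dotNl dotC dotNl opprK. Qed.

(** Division by 0 gives 0, so the formula also covers [w = 0]. *)
Lemma dot_reject u v w : dot (reject u w) (reject v w) =
  dot u v - dot u w * dot v w / dot w w.
Proof.
rewrite /reject !(dotBl, dotBr, dotZl, dotZr) (dotC w v).
have [->|w0] := eqVneq (dot w w) 0; last by field.
by rewrite invr0; ring.
Qed.

End Dot.

(** * Oriented volume and Gram determinants *)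

Lemma dot3E (R : realType) (u v : 'rV[R]_3) :
  dot u v = u 0 0 * v 0 0 + u 0 1 * v 0 1 + u 0 2 * v 0 2.
Proof.
rewrite /dot !big_ord_recr big_ord0 /= add0r.
by congr (_ * _ + _ * _ + _ * _); congr (_ 0 _); apply: val_inj.
Qed.

Lemma det_mx33 (R : comPzRingType) (M : 'M[R]_3) :
  \det M = M 0 0 * (M 1 1 * M 2 2 - M 1 2 * M 2 1)
         - M 0 1 * (M 1 0 * M 2 2 - M 1 2 * M 2 0)
         + M 0 2 * (M 1 0 * M 2 1 - M 1 1 * M 2 0).
Proof.
have -> : M = \matrix_(i, j) M (inord i) (inord j).
  by apply/matrixP => i j; rewrite mxE !inord_val.
move: (fun i j => M (inord i) (inord j)) => f.
rewrite (expand_det_row _ 0) !big_ord_recr big_ord0 /= add0r /cofactor.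
rewrite !(expand_det_row _ ord0) !big_ord_recr !big_ord0 /= /cofactor.
by rewrite !det_mx11 !mxE /=; ring.
Qed.

Lemma orientE (R : realType) (a b c x : 'rV[R]_3) :
  let u := b - a in let v := c - a in let y := x - a in
  orient a b c x =
    u 0 0 * (v 0 1 * y 0 2 - v 0 2 * y 0 1)
  - u 0 1 * (v 0 0 * y 0 2 - v 0 2 * y 0 0)
  + u 0 2 * (v 0 0 * y 0 1 - v 0 1 * y 0 0).
Proof. by move=> u v y; rewrite /orient det_mx33 !mxE. Qed.

(** The determinant of the Gram matrix of [u], [v], [y], expanded along its first row. *)
Definition gram3 (R : realType) (d : nat) (u v y : 'rV[R]_d) : R :=
  dot u u * (dot v v * dot y y - dot v y ^+ 2)
  - dot u v * (dot u v * dot y y - dot v y * dot u y)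
  + dot u y * (dot u v * dot v y - dot v v * dot u y).

(** This is det(M)^2 = det(M M^T) for the matrix M of edge vectors. *)
Lemma sqr_orient (R : realType) (a b c x : 'rV[R]_3) :
  orient a b c x ^+ 2 = gram3 (b - a) (c - a) (x - a).
Proof.
rewrite orientE /gram3 !dot3E.
set u := b - a; set v := c - a; set y := x - a; ring.
Qed.

Definition dist2 (R : realType) (d : nat) (u v : 'rV[R]_d) : R :=
  dot (u - v) (u - v).

(** The arguments are squared lengths. Polarization turns them into the inner products of the edge
    vectors at [a], and the value is their Gram determinant, an eighth of the classical
    Cayley-Menger determinant. *)
Definition cayley_menger (R : realType) (ab ac ax bc bx cx : R) : R :=
  let uv := (ab + ac - bc) / 2 in
  let uy := (ab + ax - bx) / 2 in
  let vy := (ac + ax - cx) / 2 in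
  ab * (ac * ax - vy ^+ 2) - uv * (uv * ax - vy * uy) + uy * (uv * vy - ac * uy).

Lemma sqr_orient_dist2 (R : realType) (a b c x : 'rV[R]_3) :
  orient a b c x ^+ 2 =
    cayley_menger (dist2 a b) (dist2 a c) (dist2 a x)
                  (dist2 b c) (dist2 b x) (dist2 c x).
Proof.
rewrite sqr_orient /gram3 /cayley_menger /dist2.
rewrite (dot_distC a b) (dot_distC a c) (dot_distC a x).
have E u v : u - v = (u - a) - (v - a) by rewrite opprB addrA subrK.
rewrite (E b c) (E b x) (E c x) !(dot_polar (b - a) (c - a))
  !(dot_polar (b - a) (x - a)) !(dot_polar (c - a) (x - a)).
by [].
Qed.

(** Squaring removes the sign of the permutation; what remains is the symmetry of a polynomial in
    the squared distances, checked on each of the 24 orders. *)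
Lemma orient_perm (R : realType) (s : seq 'rV[R]_3) (a b c x : 'rV[R]_3) :
  perm_eq s [:: a; b; c; x] ->
  `|orient s`_0 s`_1 s`_2 s`_3| = `|orient a b c x|.
Proof.
move=> /(perm_iotaP 0) [r r_perm ->].
suff H : orient [seq [:: a; b; c; x]`_i | i <- r]`_0
                [seq [:: a; b; c; x]`_i | i <- r]`_1
                [seq [:: a; b; c; x]`_i | i <- r]`_2
                [seq [:: a; b; c; x]`_i | i <- r]`_3 ^+ 2 = orient a b c x ^+ 2.
  by rewrite -!sqrtr_sqr H.
rewrite !sqr_orient_dist2.
have : r \in permutations (iota 0 4) by rewrite mem_permutations.
have distC (u v : 'rV[R]_3) : dist2 v u = dist2 u v by exact: dot_distC.
(* The list of the 24 permutations is made explicit, so that membership splits into concrete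
   cases. *)
let e := eval vm_compute in (permutations (iota 0 4)) in
  have -> : permutations (iota 0 4) = e by [].
rewrite !inE; do ![case/predU1P => [->|]]; last move/eqP->.
all: rewrite /= ?(distC a b) ?(distC a c) ?(distC a x) ?(distC b c) ?(distC b x)
  ?(distC c x) /cayley_menger; try field; done.
Qed.

(* Base times height: [o] is the foot of the perpendicular from [x] to the
   plane [a b c]. *)
Lemma norm_orient_orth (R : realType) (a b c o x : 'rV[R]_3) :
  orient a b c o = 0 -> dot (b - a) (x - o) = 0 -> dot (c - a) (x - o) = 0 ->
  `|orient a b c x| =
    enorm (b - a) * enorm (reject (c - a) (b - a)) * enorm (o - x).
Proof.
move=> o0 ux vx.
have -> : orient a b c x = orient a b c (a + (x - o)).
  rewrite -[LHS]subr0 -o0 !orientE !mxE; ring.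
apply/eqP; rewrite -(@eqrXn2 _ 2) ?normr_ge0 ?mulr_ge0 ?sqrtr_ge0 //.
rewrite real_normK ?num_real // sqr_orient !exprMn !sqr_enorm dot_reject.
have -> : a + (x - o) - a = x - o by rewrite addrC addKr.
rewrite /gram3 ux vx (dot_distC o x) (dotC (c - a) (b - a)).
have [->|u0] := eqVneq (b - a) 0; first by rewrite !dot0l; apply/eqP; ring.
have {}u0 : dot (b - a) (b - a) != 0 by rewrite dot_eq0.
by apply/eqP; field.
Qed.

(** The determinant is affine in its last point and vanishes at [a], [b] and [c]. *)
Lemma orient_barycentric (R : realType) (a b c x : 'rV[R]_3) (wa wb wc wx : R) :
  wa + wb + wc + wx = 1 ->
  orient a b c (wa *: a + wb *: b + wc *: c + wx *: x) = wx * orient a b c x.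
Proof.
move=> w1; have -> : wa = 1 - wb - wc - wx by rewrite -w1; ring.
by rewrite !orientE !mxE; ring.
Qed.

(** * Dihedral angles in terms of squared distances *)

Section Dist2.
Variables (R : realType) (d : nat).
Implicit Types (a b c u v : 'rV[R]_d).

Lemma dist2C u v : dist2 u v = dist2 v u.
Proof. exact: dot_distC. Qed.

Lemma dist2xx u : dist2 u u = 0.
Proof. by rewrite /dist2 subrr dot0l. Qed.

Lemma dist2_enorm u v : dist2 u v = enorm (u - v) ^+ 2.
Proof. by rewrite sqr_enorm. Qed.

Lemma dot_dist2 a u v :
  dot (u - a) (v - a) = (dist2 u a + dist2 v a - dist2 u v) / 2.
Proof. by rewrite dot_polar opprB addrA subrK. Qed.

(** Both [u] and [v] lie on the perpendicular bisector of [a] and [b]. *)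
Lemma dot_equidistant a b u v : dist2 u a = dist2 u b -> dist2 v a = dist2 v b ->
  dot (b - a) (u - v) = 0.
Proof.
rewrite /dist2 !(dotBl, dotBr) (dotC a u) (dotC b u) (dotC a v) (dotC b v).
lra.
Qed.

Definition dihedral a b u v : R :=
  angle (reject (u - a) (b - a)) (reject (v - a) (b - a)).

Lemma dihedral_dist2 a b u v (a' b' u' v' : 'rV[R]_d) :
  dist2 a b = dist2 a' b' -> dist2 a u = dist2 a' u' ->
  dist2 a v = dist2 a' v' -> dist2 b u = dist2 b' u' ->
  dist2 b v = dist2 b' v' -> dist2 u v = dist2 u' v' ->
  dihedral a b u v = dihedral a' b' u' v'.
Proof.
move=> ab au av bu bv uv.
by rewrite /dihedral /angle /enorm !dot_reject !dot_dist2 !dist2xx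
  (dist2C b a) (dist2C u a) (dist2C v a) (dist2C u b) (dist2C v b)
  (dist2C b' a') (dist2C u' a') (dist2C v' a') (dist2C u' b') (dist2C v' b')
  ab au av bu bv uv.
Qed.

Lemma dihedralC a b u v : dihedral a b u v = dihedral a b v u.
Proof. by rewrite /dihedral /angle dotC [enorm _ * _]mulrC. Qed.

(** Moving the base point along the edge changes [y - a] by a multiple of the edge vector, which
    [reject] removes. *)
Lemma dihedralC_edge a b u v : a != b -> dihedral a b u v = dihedral b a u v.
Proof.
move=> ab; suff E y : reject (y - a) (b - a) = reject (y - b) (a - b).
  by rewrite /dihedral !E.
have n0 : dot (b - a) (b - a) != 0 by rewrite dot_eq0 subr_eq0 eq_sym.
rewrite /reject (dot_distC a b) -[a - b]opprB.
have -> : y - b = (y - a) - (b - a) by rewrite opprB addrA subrK.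
move: (y - a) (b - a) n0 => {}y w w0.
rewrite (dotC _ (- w)) dotNl dotBr (dotC w y).
have -> : - (dot y w - dot w w) / dot w w = 1 - dot y w / dot w w by field.
by rewrite scalerN opprK scalerBl scale1r addrA subrK.
Qed.

End Dist2.

(** * Existence of the circumcenter *)

Section Circumcenter.
Variables (R : realType) (n : nat).
Implicit Types (p : 'I_n -> 'rV[R]_3) (l : {set 'I_n} -> R) (s f : {set 'I_n}).
Implicit Types (w : 'I_n -> R).

Lemma affinely_independent_sub p s f :
  f \subset s -> affinely_independent p s -> affinely_independent p f.
Proof.
move=> /fintype.subsetP fs ps w w0 wp0 i fi.
have E (V : nmodType) (F : 'I_n -> V) :
    \sum_(j in s) (if j \in f then F j else 0) = \sum_(j in f) F j.
  rewrite -big_mkcondr; apply: eq_bigl => j.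
  by apply: andb_idl; exact: fs.
have := ps (fun j => if j \in f then w j else 0).
rewrite E w0 => /(_ erefl).
rewrite (eq_bigr (fun j => if j \in f then w j *: p j else 0)); last first.
  by move=> j _; case: ifP; rewrite ?scale0r.
by rewrite E wp0 => /(_ erefl i (fs _ fi)); rewrite fi.
Qed.

(** Writing c = p i0 + x E, where the rows of E are the edge vectors at [i0], equidistance becomes
    the system x E E^T = b, where b lists half the squared lengths of the rows. It is solvable
    because b is orthogonal to the kernel of E E^T: if y is in this kernel then y E = 0, and affine
    independence makes y vanish wherever b may be nonzero. *)
Lemma circumcenter_exists p s i0 : i0 \in s -> affinely_independent p s ->
  exists c, affine_hull p s c /\
    forall i j, i \in s -> j \in s -> enorm (c - p i) = enorm (c - p j).
Proof.
move=> i0s ps; pose s' := s :\ i0.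
(* Rows outside [s'] are 0, which lets the system be indexed by all of ['I_n]. *)
pose E : 'M[R]_(n, 3) := \matrix_i (if i \in s' then p i - p i0 else 0).
pose b : 'rV[R]_n := \row_i (dot (row i E) (row i E) / 2).
have dotE u v : dot u v = (u *m v^T) 0 0.
  by rewrite mxE; apply: eq_bigr => k _; rewrite mxE.
have rowE i : row i E = if i \in s' then p i - p i0 else 0 by rewrite rowK.
have mulE (x : 'rV[R]_n) : x *m E = \sum_(i in s') x 0 i *: (p i - p i0).
  rewrite mulmx_sum_row [RHS]big_mkcond /=.
  by apply: eq_bigr => i _; rewrite rowE; case: ifP; rewrite ?scaler0.
(* The weight of [i0] is chosen to make the total 0, which is the form that affine independence and
   the affine hull require. *)
have combE (x : 'rV[R]_n) :
    let w i := if i == i0 then - \sum_(j in s') x 0 j else x 0 i in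
    \sum_(i in s) w i = 0 /\ \sum_(i in s) w i *: p i = x *m E.
  move=> w; rewrite mulE !(big_setD1 i0 i0s) /= /w eqxx; split.
    rewrite addrC; apply/eqP; rewrite subr_eq0; apply/eqP/eq_bigr => i.
    by rewrite in_setD1 => /andP[/negPf->].
  rewrite scaleNr scaler_suml -sumrN -big_split; apply: eq_bigr => i.
  by rewrite in_setD1 => /andP[/negPf-> _] /=; rewrite scalerBr addrC.
have : (b <= E *m E^T)%MS.
  rewrite submxE; apply/eqP/rowP => k; rewrite [RHS]mxE.
  pose y := (col k (cokermx (E *m E^T)))^T.
  have yE0 : y *m E = 0.
    apply/eqP; rewrite -dot_eq0 dotE trmx_mul trmxK.
    have : y *m (E *m E^T) = 0.
      apply: trmx_inj; rewrite trmx_mul trmxK trmx_mul trmxK trmx0.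
      by rewrite colE mulmxA mulmx_coker mul0mx.
    rewrite mulmxA => y0.
    by rewrite mulmxA y0 mul0mx mxE.
  have [w0 wE] := combE y; rewrite yE0 in wE.
  have y0 i : i \in s' -> y 0 i = 0.
    rewrite in_setD1 => /andP[/negPf i_i0 is_].
    by have := ps _ w0 wE i is_; rewrite i_i0.
  rewrite mxE big1 // => i _; rewrite mxE rowE.
  case: ifP => [/y0|_]; first by rewrite !mxE => ->; rewrite mulr0.
  by rewrite dot0l !mul0r.
case/submxP => x bE; exists (p i0 + x *m E); split.
  have [w [w0 wE]] : exists w : 'I_n -> R,
      \sum_(i in s) w i = 0 /\ \sum_(i in s) w i *: p i = x *m E.
    by eexists; exact: combE.
  exists (fun i => (i == i0)%:R + w i); rewrite !big_split /= w0 addr0; split.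
    rewrite (big_setD1 i0 i0s) /= eqxx big1 ?addr0 // => i.
    by rewrite in_setD1 => /andP[/negPf->].
  under eq_bigr do rewrite scalerDl.
  rewrite big_split /= wE (big_setD1 i0 i0s) /= eqxx scale1r big1 ?addr0 // => i.
  by rewrite in_setD1 => /andP[/negPf-> _]; rewrite scale0r.
suff H i : i \in s -> enorm (p i0 + x *m E - p i) = enorm (x *m E).
  by move=> i j /H-> /H->.
move=> si; rewrite /enorm; congr Num.sqrt.
have [->|i_i0] := eqVneq i i0; first by rewrite addrAC subrr add0r.
have s'i : i \in s' by rewrite in_setD1 i_i0.
have -> : p i0 + x *m E - p i = x *m E - row i E.
  by rewrite rowE s'i opprB addrCA addrA.
have : dot (x *m E) (row i E) = dot (row i E) (row i E) / 2.
  have := congr1 (fun M : 'rV_n => M 0 i) bE; rewrite mxE => ->.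
  rewrite dotE mulmxA [LHS]mxE [RHS]mxE; apply: eq_bigr => k _.
  by congr (_ * _); rewrite 2!mxE [in RHS]mxE.
rewrite !(dotBl, dotBr) (dotC (row i E)) => ->; lra.
Qed.

End Circumcenter.

Lemma perm_eq2 (T : eqType) (s : seq T) (a b : T) :
  perm_eq s [:: a; b] -> s = [:: a; b] \/ s = [:: b; a].
Proof.
case: s (perm_size (s1 := s) (s2 := [:: a; b])) => [|x [|y [|? ?]]] sz P;
  try by have := sz P.
have: x \in [:: a; b] by rewrite -(perm_mem P) mem_head.
rewrite !inE => /orP[] /eqP xE; move: P; rewrite xE.
  by rewrite perm_cons => /perm_small_eq -> //; left.
rewrite -[[:: a; b]]/([:: a] ++ [:: b]) perm_sym perm_catC perm_sym perm_cons.
by move=> /perm_small_eq -> //; right.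
Qed.

Lemma perm_enum_imset (T T' : finType) (f : T -> T') (s : {set T}) :
  injective f -> perm_eq (enum (f @: s)) (map f (enum s)).
Proof.
move=> f_inj; apply: uniq_perm; rewrite ?map_inj_uniq ?enum_uniq // => y.
rewrite mem_enum; apply/imsetP/mapP => -[x xs ->]; exists x => //.
  by rewrite mem_enum.
by move: xs; rewrite mem_enum.
Qed.

Lemma sum_enum4 (V : nmodType) (T : finType) (s : {set T}) a b c x (F : T -> V) :
  perm_eq (enum s) [:: a; b; c; x] -> \sum_(i in s) F i = F a + F b + F c + F x.
Proof.
by move=> es; rewrite -big_enum /= (perm_big _ es) /= !big_cons big_nil addr0 !addrA.
Qed.

(** * Volumes, areas and angles computed from any realization *)

Section Lengths.
Variables (R : realType) (n : nat) (l : {set 'I_n} -> R).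
Implicit Types (p : 'I_n -> 'rV[R]_3) (s f e : {set 'I_n}).
Implicit Types (w : 'I_n -> R).

(** The diagonal is set to 0 because [l] is unconstrained on singletons; this way it agrees with
    [dist2] on all pairs. *)
Definition length2 (i j : 'I_n) : R := if i == j then 0 else l [set i; j] ^+ 2.

Lemma realizes_dist2 p s i j : realizes l s p -> i \in s -> j \in s ->
  dist2 (p i) (p j) = length2 i j.
Proof.
move=> [_ pl] si sj; rewrite /length2; have [->|ij] := eqVneq i j.
  exact: dist2xx.
by rewrite dist2_enorm pl.
Qed.

Lemma realizes_inj p s : realizes l s p -> {in s &, injective p}.
Proof.
move=> [ps _] a b sa sb pab; apply/eqP/negP => /negP ab.
have sumE (V : nmodType) (F : 'I_n -> V) c : c \in s ->
    \sum_(i in s) (if i == c then F i else 0) = F c.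
  move=> sc; rewrite (big_setD1 c sc) /= eqxx big1 ?addr0 // => i.
  by rewrite in_setD1 => /andP[/negPf->].
(* If two vertices coincided, the weights 1 at [a] and -1 at [b] would be an affine dependence. *)
have := ps (fun i => (if i == a then 1 else 0) - (if i == b then 1 else 0)).
rewrite big_split /= sumrN !sumE // subrr => /(_ erefl).
under eq_bigr => i _ do
  rewrite scalerBl !(fun_if (fun k : R => k *: p i)) !scale0r !scale1r.
rewrite big_split /= sumrN !sumE // pab subrr => /(_ erefl _ sa).
by rewrite eqxx (negPf ab) subr0 => /eqP; rewrite oner_eq0.
Qed.

Lemma realizes_sub p s f : f \subset s -> realizes l s p -> realizes l f p.
Proof.
move=> fs [ps pl]; split; first exact: affinely_independent_sub ps.
by move=> i j /(fintype.subsetP fs) ? /(fintype.subsetP fs) ?; exact: pl.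
Qed.

Lemma realizationP p s : realizes l s p -> realizes l s (realization l s).
Proof. by move=> ?; apply: xgetPex; exists p. Qed.

Lemma tetra_volumeE p s a b c x : realizes l s p ->
  perm_eq (enum s) [:: a; b; c; x] ->
  tetra_volume l s = `|orient (p a) (p b) (p c) (p x)| / 6.
Proof.
move=> sp es; have sq := realizationP sp.
rewrite /tetra_volume /vertices.
rewrite (@orient_perm _ _ (realization l s a) (realization l s b)
  (realization l s c) (realization l s x)); last exact: perm_map es.
have mem i : i \in [:: a; b; c; x] -> i \in s by rewrite -(perm_mem es) mem_enum.
have [sa sb sc sx] : [/\ a \in s, b \in s, c \in s & x \in s].
  by rewrite !mem // !inE eqxx ?orbT.
have D i j : i \in s -> j \in s ->
    dist2 (realization l s i) (realization l s j) = dist2 (p i) (p j).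
  by move=> si sj; rewrite (realizes_dist2 sq) ?(realizes_dist2 sp).
by rewrite -!sqrtr_sqr !sqr_orient_dist2 !D.
Qed.

Lemma tetra_volume_gt0 p s : realizes l s p -> #|s| = 4 -> 0 < tetra_volume l s.
Proof.
move=> sp; rewrite cardE; case es: (enum s) => [|a [|b [|c [|x [|? ?]]]]] // _.
have es' : perm_eq (enum s) [:: a; b; c; x] by rewrite es.
rewrite (tetra_volumeE sp es') divr_gt0 ?normr_gt0 //.
apply/negP => /det0P[v /negP v0 vM]; apply: v0.
have := enum_uniq s; rewrite es /= !inE !negb_or.
case/and4P => /and3P[ab ac ax] /andP[bc bx] cx _.
have {vM} : v 0 0 *: (p b - p a) + v 0 1 *: (p c - p a) + v 0 2 *: (p x - p a) = 0.
  rewrite -[RHS]vM mulmx_sum_row !big_ord_recr big_ord0 /= add0r !rowK /=.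
  by congr (_ *: _ + _ *: _ + _ *: _); congr (v 0 _); apply: val_inj.
(* A linear dependence of the edge vectors at [a] becomes an affine dependence of the vertices once
   [a] receives minus the sum of the other weights. *)
pose w i : R := if i == b then v 0 0 else if i == c then v 0 1 else
  if i == x then v 0 2 else - (v 0 0 + v 0 1 + v 0 2).
have [wa wb wc wx] : [/\ w a = - (v 0 0 + v 0 1 + v 0 2), w b = v 0 0,
    w c = v 0 1 & w x = v 0 2].
  by split; rewrite /w ?eqxx // ?(eq_sym c b) ?(eq_sym x b) ?(eq_sym x c)
    ?(negPf ab) ?(negPf ac) ?(negPf ax) ?(negPf bc) ?(negPf bx) ?(negPf cx).
move=> vM; have [/(_ w) + _] := sp.
rewrite !(sum_enum4 _ es') wa wb wc wx => wP.
have mem i : i \in [:: a; b; c; x] -> i \in s by rewrite -es mem_enum.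
have {}wP i : i \in s -> w i = 0.
  apply: wP; first by ring.
  rewrite -[RHS]vM scaleNr !scalerBr !scalerDl; apply/rowP => k; rewrite !mxE; ring.
apply/eqP/rowP => -[[|[|[|k]]] lt3] //; rewrite mxE.
- by rewrite -[RHS](wP b) ?wb ?mem ?inE ?eqxx ?orbT //; congr (v 0 _); apply: val_inj.
- by rewrite -[RHS](wP c) ?wc ?mem ?inE ?eqxx ?orbT //; congr (v 0 _); apply: val_inj.
- by rewrite -[RHS](wP x) ?wx ?mem ?inE ?eqxx ?orbT //; congr (v 0 _); apply: val_inj.
Qed.

(** The area of a triangle is defined by its own realization; this transfers it to the realization
    of a tetrahedron containing it, where the height is measured. *)
Lemma triangle_areaE p f a b c : realizes l f p -> enum f = [:: a; b; c] ->
  triangle_area l f =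
    enorm (p b - p a) * enorm (reject (p c - p a) (p b - p a)) / 2.
Proof.
move=> fp ef; have fq := realizationP fp.
have mem i : i \in [:: a; b; c] -> i \in f by rewrite -ef mem_enum.
rewrite /triangle_area /vertices ef /= /enorm !dot_reject !dot_dist2.
by rewrite !(realizes_dist2 fp) ?(realizes_dist2 fq) // mem // !inE eqxx ?orbT.
Qed.

Lemma dihedral_angleE p s e a b c d : realizes l s p ->
  perm_eq (enum e) [:: a; b] -> perm_eq (enum (s :\: e)) [:: c; d] ->
  e \subset s ->
  dihedral_angle l e s = dihedral (p a) (p b) (p c) (p d).
Proof.
move=> sp ee ed es; have sq := realizationP sp.
have mem i : i \in [:: a; b; c; d] -> i \in s.
  rewrite -[[:: a; b; c; d]]/([:: a; b] ++ [:: c; d]) mem_cat.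
  rewrite -(perm_mem ee) -(perm_mem ed) !mem_enum finset.in_setD.
  by case/orP => [/(fintype.subsetP es)|/andP[]].
have ab : a != b.
  by have := perm_uniq ee; rewrite enum_uniq /= inE andbT => <-.
have [sa [sb [sc sd]]] : a \in s /\ b \in s /\ c \in s /\ d \in s.
  by rewrite !mem // !inE eqxx ?orbT.
rewrite /dihedral_angle /vertices.
have qab : realization l s a != realization l s b.
  by apply: contraNneq ab => /(realizes_inj sq sa sb) ->.
have <- : dihedral (realization l s a) (realization l s b)
    (realization l s c) (realization l s d) = dihedral (p a) (p b) (p c) (p d).
  by apply: dihedral_dist2; rewrite !(realizes_dist2 sp) ?(realizes_dist2 sq).
case: (perm_eq2 ee) => ->; case: (perm_eq2 ed) => -> /=.
- by [].
- exact: dihedralC.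
- by rewrite (dihedralC_edge _ _ qab).
- by rewrite (dihedralC_edge _ _ qab); exact: dihedralC.
Qed.

End Lengths.

(** * Barycentric coordinates of the circumcenter *)

Section Weights.
Variables (R : realType) (n : nat) (l : {set 'I_n} -> R).
Implicit Types (p : 'I_n -> 'rV[R]_3) (s f e : {set 'I_n}).
Implicit Types (w : 'I_n -> R).

(* Barycentric coordinates of the circumcenter of [s]. For [c] with barycentric
   coordinates [w], the sum [\sum_j w j * dist2 (p i) (p j)] exceeds
   [dist2 c (p i)] by an amount independent of [i], so that equidistance can be
   read off the lengths alone. *)
Definition circum_weights s w : Prop :=
  \sum_(i in s) w i = 1 /\
  exists k, forall i, i \in s -> \sum_(j in s) w j * length2 l i j = k.

(** The difference u has total 0, and its weighted sums of squared distances are constant on [s], so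
    the vector U = sum of u_i p_i has the same inner product with every vertex. Hence U.U is this
    constant times the total of u, which is 0, and affine independence gives u = 0. *)
Lemma circum_weights_unique p s w w' : realizes l s p ->
  circum_weights s w -> circum_weights s w' -> {in s, w =1 w'}.
Proof.
move=> sp [w1 [k wk]] [w'1 [k' w'k]].
pose u i := w i - w' i; pose U := \sum_(i in s) u i *: p i.
have u0 : \sum_(i in s) u i = 0 by rewrite sumrB w1 w'1 subrr.
have UE i : i \in s -> dot U (p i) =
    (\sum_(j in s) u j * dot (p j) (p j) - (k - k')) / 2.
  move=> si; have : \sum_(j in s) u j * length2 l i j = k - k'.
    rewrite -(wk _ si) -(w'k _ si) -sumrB.
    by apply: eq_bigr => j _; rewrite mulrBl.
  have -> : \sum_(j in s) u j * length2 l i j =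
      \sum_(j in s) u j * dot (p j) (p j) - 2 * dot U (p i).
    transitivity (\sum_(j in s) (u j * dot (p j) (p j) -
      2 * dot (u j *: p j) (p i) + u j * dot (p i) (p i))).
      apply: eq_bigr => j sj; rewrite -(realizes_dist2 sp) // /dist2.
      rewrite dotZl !(dotBl, dotBr) (dotC (p i)); ring.
    by rewrite big_split sumrB /= -mulr_suml u0 mul0r addr0 -mulr_sumr -dot_suml.
  by move=> <-; field.
have U0 : U = 0.
  apply/eqP; rewrite -dot_eq0 {1}/U dot_suml.
  rewrite (eq_bigr (fun i => u i * ((\sum_(j in s) u j * dot (p j) (p j) -
    (k - k')) / 2))) => [|i si]; last by rewrite dotZl dotC UE.
  by rewrite -mulr_suml u0 mul0r.
move=> i si; apply/eqP; rewrite -subr_eq0; apply/eqP.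
by have [ps _] := sp; exact: ps U0 i si.
Qed.

Lemma circum_weightsP p s w c : realizes l s p -> \sum_(i in s) w i = 1 ->
  c = \sum_(i in s) w i *: p i ->
  (forall i j, i \in s -> j \in s -> enorm (c - p i) = enorm (c - p j)) ->
  circum_weights s w.
Proof.
move=> sp w1 cE ceq; split=> //.
have [->|[i0 i0s]] := set_0Vmem s.
  by exists 0 => i; rewrite inE.
exists (dist2 c (p i0) + \sum_(j in s) w j * dist2 c (p j)) => i si.
rewrite !dist2_enorm (ceq i0 i) // -!dist2_enorm.
(* Since [c] is the barycenter for the weights [w], the cross terms cancel when the squared
   distances are expanded around [c]. *)
have wc : \sum_(j in s) w j *: (p j - c) = 0.
  under eq_bigr do rewrite scalerBr.
  by rewrite sumrB -cE -scaler_suml w1 scale1r subrr.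
transitivity (\sum_(j in s) (w j * dist2 c (p i) + w j * dist2 c (p j) -
    2 * dot (w j *: (p j - c)) (p i - c))).
  apply: eq_bigr => j sj; rewrite -(realizes_dist2 sp) //.
  by rewrite dotZl dot_dist2 !(dist2C c) (dist2C (p i)); field.
by rewrite sumrB big_split /= -mulr_suml w1 mul1r -mulr_sumr -dot_suml wc dot0l
  mulr0 subr0.
Qed.

(** The segment joining the two circumcenters is perpendicular to the face, so the distance times
    the face area is half the absolute oriented volume at the circumcenter of [s]. That oriented
    volume is [w x] times the one at [x], and the side test supplies the sign of [w x]. *)
Lemma signed_height_area s x w :
  (exists p, realizes l s p) -> #|s| = 4 -> x \in s -> circum_weights s w ->
  signed_height l (s :\ x) s * triangle_area l (s :\ x) =
    3 * tetra_volume l s * w x.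
Proof.
move=> [p0 sp0] s4 sx ws; have sp := realizationP sp0.
rewrite /signed_height; set p := realization l s.
have fs : s :\ x \subset s by apply: subD1set.
have fp := realizes_sub fs sp.
have : #|s :\ x| = 3 by move: s4; rewrite (cardsD1 x s) sx => -[].
rewrite cardE; case ef: (enum (s :\ x)) => [|a [|b [|c [|? ?]]]] // _.
have mem i : i \in [:: a; b; c] -> i \in s :\ x by rewrite -ef mem_enum.
have es : perm_eq (enum s) [:: a; b; c; x].
  rewrite -[[:: a; b; c; x]]/([:: a; b; c] ++ [:: x]) perm_sym perm_catC perm_sym.
  rewrite -ef; apply: uniq_perm; rewrite ?enum_uniq //=.
    by rewrite mem_enum setD11 enum_uniq.
  by move=> i; rewrite !inE !mem_enum in_setD1; case: eqVneq => // ->.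
have [fa fb fc] : [/\ a \in s :\ x, b \in s :\ x & c \in s :\ x].
  by rewrite !mem // !inE eqxx ?orbT.
have := sp.1; move=> sind.
have [[w0 [w01 cE]] ceq] :
    affine_hull p s (circumcenter p s) /\ forall i j, i \in s -> j \in s ->
    enorm (circumcenter p s - p i) = enorm (circumcenter p s - p j).
  by apply: (xgetPex _ (circumcenter_exists sx sind)).
have [[v [v1 oE]] oeq] :
    affine_hull p (s :\ x) (circumcenter p (s :\ x)) /\
    forall i j, i \in s :\ x -> j \in s :\ x ->
    enorm (circumcenter p (s :\ x) - p i) = enorm (circumcenter p (s :\ x) - p j).
  exact: (xgetPex _ (circumcenter_exists fa fp.1)).
(* Uniqueness identifies the given weights with the coordinates of the chosen circumcenter. *)
have ww0 : {in s, w =1 w0}.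
  by apply: circum_weights_unique ws _; [exact: sp|exact: circum_weightsP cE ceq].
move: (circumcenter p s) (circumcenter p (s :\ x)) cE ceq oE oeq => q o qE qeq oE oeq.
have orq : orient (p a) (p b) (p c) q = w x * orient (p a) (p b) (p c) (p x).
  rewrite qE (sum_enum4 _ es) orient_barycentric ?ww0 //.
  by rewrite -w01 (sum_enum4 _ es).
have oro : orient (p a) (p b) (p c) o = 0.
  have sum3 (V : nmodType) (F : 'I_n -> V) : \sum_(i in s :\ x) F i = F a + F b + F c.
    by rewrite -big_enum ef /= !big_cons big_nil addr0 !addrA.
  have := @orient_barycentric _ (p a) (p b) (p c) 0 (v a) (v b) (v c) 0.
  rewrite scaler0 !addr0 mul0r oE sum3 => -> //.
  by rewrite -v1 sum3.
have fsP i : i \in s :\ x -> i \in s by exact: (fintype.subsetP fs).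
have orth i : i \in s :\ x -> dot (p i - p a) (q - o) = 0.
  move=> fi; apply: dot_equidistant; rewrite !dist2_enorm.
    by rewrite (qeq a i) ?fsP.
  by rewrite (oeq a i).
have xE : enum (s :\: (s :\ x)) = [:: x].
  have -> : s :\: (s :\ x) = [set x]; last by rewrite enum_set1.
  apply/setP => i; rewrite !inE; case: eqVneq => [->|] //=.
  by rewrite andNb.
rewrite /vertices ef xE /= (triangle_areaE fp ef) (tetra_volumeE sp es) orq.
have := norm_orient_orth oro (orth b fb) (orth c fc); rewrite orq normrM.
set D := orient _ _ _ _; set A := _ * enorm (reject _ _); set d := enorm _.
move=> wD; have -> : 3 * (`|D| / 6) * w x = w x * `|D| / 2 by field.
(* For nonzero [D] the side test amounts to [0 < w x]. If [D = 0] or [w x = 0], distance times area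
   is 0, so either branch gives the right value. *)
have sgE : (Num.sg (w x * D) == Num.sg D) = (D == 0) || (0 < w x).
  rewrite sgrM; have [->|D0] := eqVneq D 0; first by rewrite sgr0 mulr0 eqxx.
  by rewrite -subr_eq0 -{2}[Num.sg D]mul1r -mulrBl mulf_eq0 sgr_eq0
    (negPf D0) orbF subr_eq0 sgr_cp0.
rewrite sgE; have [D0|D0] := eqVneq D 0.
  move: wD; rewrite D0 normr0 !mulr0 /= => Ad.
  have -> : d * (A / 2) = A * d / 2 by ring.
  by rewrite -Ad mul0r.
rewrite /=; have [wx|wx|wx] := ltgtP 0 (w x).
- by move: wD; rewrite gtr0_norm // => ->; ring.
- by move: wD; rewrite ltr0_norm // mulNr => /(canRL (@opprK _)) ->; ring.
move: wD; rewrite -wx normr0 !mul0r => Ad.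
have -> : - d * (A / 2) = - (A * d) / 2 by ring.
by rewrite -Ad oppr0 mul0r.
Qed.

End Weights.

(** * The boundary complex *)

Section BoundaryComplex.
Variables (R : realType) (n : nat) (t : 'I_n -> R).
Hypothesis n_ge5 : (5 <= n)%N.
Hypothesis t_incr : forall i j : 'I_n, (i < j)%N -> t i < t j.
Implicit Types (s : {set 'I_n}) (q : {poly R}).

Lemma incr_le (i j : 'I_n) : (i <= j)%N -> t i <= t j.
Proof. by rewrite leq_eqVlt => /orP[/eqP/val_inj->|/t_incr/ltW]. Qed.

Lemma incr_inj : injective t.
Proof.
move=> i j tij; case: (ltngtP i j) => [/t_incr|/t_incr|/val_inj //];
  by rewrite tij ltxx.
Qed.

Lemma vertex_in_polytope i : cyclic_polytope t (moment_curve (t i)).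
Proof.
exists (fun j => (j == i)%:R); split=> [j||]; first by rewrite ler0n.
  by rewrite (bigD1 i) //= eqxx big1 ?addr0 // => j /negPf->.
by rewrite (bigD1 i) //= eqxx scale1r big1 ?addr0 // => j /negPf->; rewrite scale0r.
Qed.

(** Along the moment curve, affine functionals on R^4 are the polynomials of degree at most 4.
    Supporting hyperplanes thus become polynomials that are nonnegative at the parameters, with the
    vertices on the face as roots. *)
Lemma horner_dot_moment q x : (size q <= 5)%N ->
  dot (\row_(k < 4) - q`_k.+1) (moment_curve x) = q`_0 - q.[x].
Proof.
move=> q5; rewrite (horner_coef_wide _ q5) big_ord_recl expr0 mulr1 /= opprD addrA.
rewrite subrr sub0r -sumrN; apply: eq_bigr => k _.
by rewrite !mxE mulNr.
Qed.

Lemma boundary_complex_poly s : s \in boundary_complex t ->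
  exists q, [/\ (size q <= 5)%N, q != 0, forall i, 0 <= q.[t i] &
    forall i, (i \in s) = root q (t i)].
Proof.
rewrite inE => /asboolP[F [[a [b [ab FE]]] _ FP sF]].
pose q := \poly_(k < 5) (if k is k'.+1 then - a 0 (inord k') else b).
have q5 : (size q <= 5)%N by exact: size_poly.
have qE x : q.[x] = b - dot a (moment_curve x).
  have := horner_dot_moment x q5.
  have -> : \row_(k < 4) - q`_k.+1 = a.
    apply/rowP => k; rewrite mxE coef_poly ltnS ltn_ord opprK.
    by congr (a _ _); rewrite inord_val.
  by rewrite coef_poly /= => ->; rewrite opprB addrC subrK.
have hull := vertex_in_polytope.
exists q; split=> //.
(* If [q] were 0, all vertices, and by convexity the whole polytope, would lie on the hyperplane,
   against properness of the face. *)
- apply: contra_notN FP => /eqP q0; rewrite FE; apply/seteqP; split=> [x []//|x Px].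
  split=> //=; case: Px => w [_ w1 ->].
  rewrite dotC dot_suml -[RHS]mulr1 -w1 mulr_sumr; apply: eq_bigr => i _.
  rewrite dotZl dotC mulrC; congr (_ * _); apply/eqP.
  by rewrite -subr_eq0 -oppr_eq0 opprB -qE q0 horner0.
- by move=> i; rewrite qE subr_ge0; exact: ab.
- move=> i; apply/idP/rootP; rewrite qE.
    by move/sF; rewrite FE => -[_ /= ->]; rewrite subrr.
  by move/subr0_eq => bE; apply/sF; rewrite FE; split.
Qed.

Lemma poly_boundary_complex s q : s != finset.set0 -> s != [set: 'I_n]%SET ->
  (size q <= 5)%N -> (forall i, 0 <= q.[t i]) ->
  (forall i, (i \in s) = root q (t i)) -> s \in boundary_complex t.
Proof.
move=> s0 sT q5 q_ge0 qs; rewrite inE; apply/asboolP.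
pose a : 'rV[R]_4 := \row_(k < 4) - q`_k.+1.
have hull := vertex_in_polytope.
have aE x : dot a (moment_curve x) = q`_0 - q.[x] by exact: horner_dot_moment.
pose F := (cyclic_polytope t `&` [set x | dot a x = q`_0])%classic.
have FE i : (i \in s) <-> F (moment_curve (t i)).
  rewrite qs /F /= aE; split=> [/rootP->|[_ /eqP]].
    by rewrite subr0; split.
  by rewrite -subr_eq0 addrAC subrr sub0r oppr_eq0.
exists F; split=> //.
- exists a, q`_0; split=> // x [w [w_ge0 w1 ->]].
  rewrite dotC dot_suml -[leRHS]mulr1 -w1 mulr_sumr; apply: ler_sum => i _.
  by rewrite dotZl dotC mulrC ler_wpM2r // aE gerBl.
- by case/finset.set0Pn: s0 => i /FE; exists (moment_curve (t i)).
- move=> FP; case/eqP: sT; apply/setP => i; rewrite inE; apply/FE.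
  by rewrite FP.
Qed.

(* For [i] the last index, the roots are the extreme parameters and the
   parabola opens downwards. *)
Lemma consecutive_pair_poly i s : s \subset [set i; ordS i] ->
  exists q, [/\ (size q <= 3)%N, forall k, 0 <= q.[t k] &
    forall k, (k \in s) = root q (t k)].
Proof.
move=> /fintype.subsetP sP.
have sE k : (k \in s) = ((k == i) && (i \in s)) || ((k == ordS i) && (ordS i \in s)).
  apply/idP/orP => [ks|[]/andP[/eqP->//]].
  by have := sP _ ks; rewrite !inE => /orP[]/eqP kE; [left|right];
    rewrite -kE eqxx ks.
have size2 (a b : R) : size (('X - a%:P) * ('X - b%:P)) = 3.
  by rewrite size_monicM ?monicXsubC ?polyXsubC_eq0 // !size_XsubC.
have rootE k j : root ('X - (t j)%:P) (t k) = (k == j).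
  by rewrite root_XsubC (inj_eq incr_inj).
case: (boolP (i \in s)) => si; case: (boolP (ordS i \in s)) => sSi.
- have [iS|iS] := ltnP i.+1 n.
    exists (('X - (t i)%:P) * ('X - (t (ordS i))%:P)); rewrite size2; split=> // k.
      rewrite hornerM !hornerXsubC; have [ki|ik] := leqP k i.
        by rewrite -mulrNN mulr_ge0 // oppr_ge0 subr_le0 incr_le //= modn_small // ltnW.
      by rewrite mulr_ge0 // subr_ge0 incr_le //= ?modn_small // ltnW.
    by rewrite sE si sSi !andbT rootM !rootE.
  have iE : i.+1 = n by apply/eqP; rewrite eqn_leq ltn_ord.
  exists (- (('X - (t i)%:P) * ('X - (t (ordS i))%:P))).
  rewrite size_polyN size2; split=> // k.
    rewrite hornerN hornerM !hornerXsubC -mulNr opprB mulr_ge0 // subr_ge0 incr_le //=.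
      by rewrite -ltnS iE.
    by rewrite iE modnn.
  by rewrite sE si sSi !andbT rootN rootM !rootE.
(* A double root isolates a single vertex without a change of sign. *)
- exists (('X - (t i)%:P) * ('X - (t i)%:P)); rewrite size2; split=> // k.
    by rewrite hornerM -expr2 sqr_ge0.
  by rewrite sE si (negPf sSi) andbT andbF orbF rootM !rootE orbb.
- exists (('X - (t (ordS i))%:P) * ('X - (t (ordS i))%:P)); rewrite size2; split=> // k.
    by rewrite hornerM -expr2 sqr_ge0.
  by rewrite sE sSi (negPf si) andbT andbF rootM !rootE orbb.
- exists 1; rewrite size_poly1; split=> // k; first by rewrite hornerC ler01.
  by rewrite sE (negPf si) (negPf sSi) !andbF (negPf (root1 _)).
Qed.

(** The product of one nonnegative quadratic for each pair has degree at most 4 and vanishes exactly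
    at the vertices of [s]. Arbitrary nonempty subsets are allowed, so edges, triangles and
    tetrahedra are covered together. *)
Lemma boundary_complex_pairs s i j : s != finset.set0 ->
  s \subset [set i; ordS i] :|: [set j; ordS j] -> s \in boundary_complex t.
Proof.
move=> s0 sij.
have [q [q3 q_ge0 qE]] := consecutive_pair_poly (subsetIr s [set i; ordS i]).
have [r [r3 r_ge0 rE]] := consecutive_pair_poly (subsetIr s [set j; ordS j]).
apply: (@poly_boundary_complex s (q * r)) => //.
(* Two pairs contain at most 4 of the at least 5 indices, so [s] is a proper subset. *)
- apply: contraTneq n_ge5 => sT; rewrite -ltnNge -[n]card_ord -cardsT -sT.
  rewrite ltnS (leq_trans (subset_leq_card sij)) // (leq_trans (leq_card_setU _ _)) //.
  by rewrite (leq_add (n1 := 2) (n2 := 2)) // cards2 ltnS leq_b1.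
- by apply: leq_trans (size_polyMleq _ _) _; move: q3 r3; lia.
- by move=> k; rewrite hornerM mulr_ge0.
- move=> k; rewrite rootM -qE -rE !(finset.in_setI, inE) -andb_orr.
  apply/idP/andP => [ks|[]//]; split=> //.
  by have /fintype.subsetP/(_ _ ks) := sij; rewrite !inE.
Qed.

Lemma sorted_enum_ord s : sorted (fun i j : 'I_n => (i < j)%N) (enum s).
Proof.
have := iota_ltn_sorted 0 n; rewrite -val_enum_ord sorted_map enumT.
by apply: sorted_filter => y x z; exact: ltn_trans.
Qed.

(** The four vertices a < b < c < d are all the roots of the polynomial, all simple, so its signs
    alternate and no parameter lies where it is negative. A positive leading coefficient forbids
    indices between a and b and between c and d. A negative one forbids them between b and c, before
    a and after d, so that d and a are the last and the first index, adjacent on the cycle. *)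
Lemma tetrahedra_pairs s : s \in tetrahedra t -> exists i j,
  s \subset [set i; ordS i] :|: [set j; ordS j].
Proof.
rewrite inE => /andP[/boundary_complex_poly[q [q5 q0 q_ge0 qs]] /eqP].
have := sorted_enum_ord s; rewrite cardE.
case es: (enum s) => [|a [|b [|c [|d [|? ?]]]]] //= /and4P[ab bc cd _] _.
have sE i : (i \in s) = (i \in [:: a; b; c; d]) by rewrite -es mem_enum.
have [k k0 qE] : exists2 k, k != 0 & forall x,
    q.[x] = k * ((x - t a) * (x - t b) * (x - t c) * (x - t d)).
  pose rs := [:: t a; t b; t c; t d].
  have rs_uniq : uniq rs.
    by rewrite (map_inj_uniq incr_inj [:: a; b; c; d]) -es enum_uniq.
  have rs_root : all (root q) rs.
    by rewrite /= -!qs !sE !inE !eqxx ?orbT.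
  have sq : size q = (size rs).+1.
    by apply/eqP; rewrite eqn_leq q5 (max_poly_roots q0 rs_root rs_uniq).
  exists (lead_coef q); first by rewrite lead_coef_eq0.
  move=> x; rewrite {1}(all_roots_prod_XsubC sq rs_root); last by rewrite uniq_rootsE.
  rewrite hornerZ !big_cons big_nil mulr1 !hornerM !hornerXsubC; ring.
have subP i j : (forall k, k \in [:: a; b; c; d] ->
    [|| k == i, k == ordS i, k == j | k == ordS j]) ->
    s \subset [set i; ordS i] :|: [set j; ordS j].
  by move=> H; apply/fintype.subsetP => x; rewrite sE => /H; rewrite !inE -orbA.
have neg x : k < 0 -> ~ 0 < (t x - t a) * (t x - t b) * (t x - t c) * (t x - t d).
  by move=> k_lt0 P; have := q_ge0 x; rewrite qE leNgt nmulr_rlt0 // P.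
have pos x : 0 < k -> ~ 0 < - ((t x - t a) * (t x - t b) * (t x - t c) * (t x - t d)).
  by move=> k_gt0; rewrite oppr_gt0 => P; have := q_ge0 x;
    rewrite qE leNgt pmulr_rlt0 // P.
have ordS_val (x y : 'I_n) :
    (x < y)%N -> (forall z : 'I_n, ~ (x < z < y)%N) -> y = ordS x.
  move=> xy xzy; apply/val_inj; rewrite /= modn_small ?(leq_ltn_trans xy) //.
  apply/eqP; rewrite eqn_leq xy andbT leqNgt; apply/negP => Sxy.
  have Sx : (x.+1 < n)%N by exact: ltn_trans Sxy (ltn_ord y).
  by apply: (xzy (Ordinal Sx)); rewrite /= ltnS leqnn.
have gap (x y : 'I_n) : (x < y)%N -> 0 < t y - t x by move=> /t_incr; rewrite subr_gt0.
have [k_lt0|k_gt0|kE] := ltgtP k 0; last by rewrite kE eqxx in k0.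
  exists b, d; apply: subP.
  have cE : c = ordS b.
    apply: ordS_val => // z /andP[bz zc]; apply: (neg z) => //.
    have -> : (t z - t a) * (t z - t b) * (t z - t c) * (t z - t d) =
      (t z - t a) * (t z - t b) * (t c - t z) * (t d - t z) by ring.
    by rewrite !mulr_gt0 ?gap //; lia.
  have dE : d.+1 = n.
    apply/eqP; rewrite eqn_leq ltn_ord leqNgt; apply/negP => dn.
    apply: (neg (Ordinal dn)) => //.
    by rewrite !mulr_gt0 ?gap //=; lia.
  have aE : a = ordS d.
    apply/val_inj; rewrite /= dE modnn; apply/eqP; rewrite eqn0Ngt; apply/negP => a_gt0.
    have n_gt0 : (0 < n)%N by lia.
    apply: (neg (Ordinal n_gt0)) => //; set z := Ordinal _.
    have -> : (t z - t a) * (t z - t b) * (t z - t c) * (t z - t d) =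
      (t a - t z) * (t b - t z) * (t c - t z) * (t d - t z) by ring.
    by rewrite !mulr_gt0 ?gap //=; lia.
  by move=> x; rewrite !inE -cE -aE => /or4P[]->; rewrite ?orbT.
exists a, c; apply: subP.
have bE : b = ordS a.
  apply: ordS_val => // z /andP[az zb]; apply: (pos z) => //.
  have -> : - ((t z - t a) * (t z - t b) * (t z - t c) * (t z - t d)) =
    (t z - t a) * (t b - t z) * (t c - t z) * (t d - t z) by ring.
  by rewrite !mulr_gt0 ?gap //; lia.
have dE : d = ordS c.
  apply: ordS_val => // z /andP[cz zd]; apply: (pos z) => //.
  have -> : - ((t z - t a) * (t z - t b) * (t z - t c) * (t z - t d)) =
    (t z - t a) * (t z - t b) * (t z - t c) * (t d - t z) by ring.
  by rewrite !mulr_gt0 ?gap //; lia.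
by move=> x; rewrite !inE -bE -dE => /or4P[]->; rewrite ?orbT.
Qed.

End BoundaryComplex.

(** * Invariance under rotation *)

Lemma subset_imset_inj (T T' : finType) (g : T -> T') (A B : {set T}) :
  injective g -> (g @: A \subset g @: B) = (A \subset B).
Proof.
move=> g_inj; apply/idP/idP => [/fintype.subsetP gAB|]; last exact: imsetS.
by apply/fintype.subsetP => x /(imset_f g)/gAB; rewrite mem_imset.
Qed.

Lemma imsetD_inj (T T' : finType) (g : T -> T') (A B : {set T}) :
  injective g -> g @: (A :\: B) = (g @: A) :\: (g @: B).
Proof.
move=> g_inj; apply/setP => y; rewrite finset.in_setD.
apply/imsetP/andP => [[x + ->]|[+ /imsetP[x Ax yE]]].
  by rewrite finset.in_setD !mem_imset // => /andP.
by rewrite yE mem_imset // => Bx; exists x => //; rewrite finset.in_setD Bx.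
Qed.

Lemma enum_card2 (T : finType) (A : {set T}) :
  #|A| = 2 -> exists a b, enum A = [:: a; b].
Proof. by rewrite cardE; case: (enum A) => [|a [|b []]] // _; exists a, b. Qed.

Lemma exists_circum_weights (R : realType) (n : nat) (l : {set 'I_n} -> R)
    (s : {set 'I_n}) (x : 'I_n) :
  (exists p, realizes l s p) -> x \in s -> exists w, circum_weights l s w.
Proof.
move=> [p sp] sx; have [sind _] := sp.
have [c [[w [w1 cE]] ceq]] := circumcenter_exists sx sind.
by exists w; exact: circum_weightsP cE ceq.
Qed.

(** * Tetrahedra under a length-preserving relabelling *)

Section Relabelling.
Variables (R : realType) (n : nat) (l : {set 'I_n} -> R) (g : 'I_n -> 'I_n).
Variable (s : {set 'I_n}).
Hypothesis g_inj : injective g.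
Hypothesis gl : forall i j, length2 l (g i) (g j) = length2 l i j.
Hypothesis s4 : #|s| = 4.
Hypothesis sr : exists p, realizes l s p.
Hypothesis gsr : exists p, realizes l (g @: s) p.

Lemma tetra_volume_relabel : tetra_volume l (g @: s) = tetra_volume l s.
Proof.
have [[p sp] [q gsq]] := (sr, gsr).
move: (s4); rewrite cardE; case es: (enum s) => [|a [|b [|c [|x [|? ?]]]]] // _.
have mem i : i \in [:: a; b; c; x] -> i \in s by rewrite -es mem_enum.
have es' : perm_eq (enum s) [:: a; b; c; x] by rewrite es.
have egs := perm_enum_imset s g_inj; rewrite es in egs.
rewrite (tetra_volumeE sp es') (tetra_volumeE gsq egs).
have [sa sb sc sx] : [/\ a \in s, b \in s, c \in s & x \in s].
  by rewrite !mem // !inE eqxx ?orbT.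
have D i j : i \in s -> j \in s -> dist2 (q (g i)) (q (g j)) = dist2 (p i) (p j).
  by move=> si sj; rewrite (realizes_dist2 gsq) ?imset_f // gl (realizes_dist2 sp).
by rewrite -!sqrtr_sqr !sqr_orient_dist2 !D.
Qed.

Lemma dihedral_angle_relabel (e : {set 'I_n}) : #|e| = 2 -> e \subset s ->
  dihedral_angle l (g @: e) (g @: s) = dihedral_angle l e s.
Proof.
have [[p sp] [q gsq]] := (sr, gsr).
move=> e2 es; have d2 : #|s :\: e| = 2 by rewrite cardsDS // s4 e2.
have [[a [b ee]] [c [d ed]]] := (enum_card2 e2, enum_card2 d2).
have mem i : i \in [:: a; b; c; d] -> i \in s.
  rewrite -[[:: a; b; c; d]]/([:: a; b] ++ [:: c; d]) mem_cat.
  rewrite -ee -ed !mem_enum finset.in_setD.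
  by case/orP => [/(fintype.subsetP es)|/andP[]].
have gD : (g @: s) :\: (g @: e) = g @: (s :\: e).
  by rewrite imsetD_inj.
have ege := perm_enum_imset e g_inj; rewrite ee in ege.
have egd := perm_enum_imset (s :\: e) g_inj; rewrite ed -gD in egd.
rewrite (dihedral_angleE gsq ege egd (imsetS _ es)).
rewrite (dihedral_angleE (a := a) (b := b) (c := c) (d := d) sp _ _ es) ?ee ?ed //.
have [sa sb sc sd] : [/\ a \in s, b \in s, c \in s & d \in s].
  by rewrite !mem // !inE eqxx ?orbT.
have D i j : i \in s -> j \in s -> dist2 (q (g i)) (q (g j)) = dist2 (p i) (p j).
  by move=> si sj; rewrite (realizes_dist2 gsq) ?imset_f // gl (realizes_dist2 sp).
by apply: dihedral_dist2; exact: D.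
Qed.

(** Circumcentric weights of the image, composed with [g], are circumcentric weights of [s], because
    their defining condition involves lengths only. *)
Lemma signed_height_area_relabel x : x \in s ->
  signed_height l (g @: s :\ g x) (g @: s) * triangle_area l (g @: s :\ g x) =
  signed_height l (s :\ x) s * triangle_area l (s :\ x).
Proof.
move=> sx; have gsx : g x \in g @: s by rewrite imset_f.
have [w gsw] := exists_circum_weights gsr gsx.
have sw : circum_weights l s (w \o g).
  case: gsw => w1 [k wk]; split.
    by rewrite -w1 big_imset //= => i j _ _; exact: g_inj.
  exists k => i si; rewrite -(wk _ (imset_f g si)) big_imset /=; last first.
    by move=> ? ? _ _; exact: g_inj.
  by apply: eq_bigr => j _; rewrite gl.
rewrite (signed_height_area sr s4 sx sw).
by rewrite (signed_height_area gsr _ gsx gsw) ?card_imset // tetra_volume_relabel.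
Qed.

End Relabelling.

(** Paths are transported by [ordS] and back by [ord_pred], so the tests searched by [find] agree
    for every length. *)
Lemma cycle_dist_ordS (n : nat) (i j : 'I_n) :
  cycle_dist (ordS i) (ordS j) = cycle_dist i j.
Proof.
apply: eq_find => k.
have adjS (x y : 'I_n) : cycle_adj (ordS x) (ordS y) = cycle_adj x y.
  by rewrite /cycle_adj !(inj_eq (@ordS_inj n)).
have adjP (x y : 'I_n) : cycle_adj (ord_pred x) (ord_pred y) = cycle_adj x y.
  by rewrite -adjS !ord_predK.
apply/existsP/existsP => -[p /andP[pp /eqP lp]].
  exists [tuple of map (@ord_pred n) p]; rewrite /= -[i](@ordSK n) path_map.
  by rewrite (eq_path (e' := @cycle_adj n)) ?pp //= last_map lp ordSK eqxx.
exists [tuple of map (@ordS n) p]; rewrite /= path_map.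
by rewrite (eq_path (e' := @cycle_adj n)) ?pp //= last_map lp eqxx.
Qed.

(** * Rotation invariance for a cyclic length metric *)

Section CyclicMetric.
Variables (R : realType) (n : nat) (t : 'I_n -> R) (l : {set 'I_n} -> R).
Hypothesis n_ge5 : (5 <= n)%N.
Hypothesis t_incr : forall i j : 'I_n, (i < j)%N -> t i < t j.
Hypothesis l_cyclic : is_cyclic_length_metric t l.
Implicit Types (s e f : {set 'I_n}) (v x : 'I_n).
Local Notation rot := (fun s : {set 'I_n} => [set ordS x | x in s]%SET).

Let rot_inj : injective rot := imset_inj (@ordS_inj n).

(** Neighborliness: any two indices are covered by the cyclic edges starting at them. *)
Lemma edgesE e : (e \in edges t) = (#|e| == 2).
Proof.
rewrite inE andb_idl // => /eqP e2.
have /cards2P[i [j [ij eE]]] : #|e| == 2 by rewrite e2.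
apply: (boundary_complex_pairs n_ge5 t_incr (i := i) (j := j)).
  by rewrite -card_gt0 e2.
by rewrite eE finset.subUset !finset.sub1set !inE !eqxx ?orbT.
Qed.

Lemma trianglesE s f : s \in tetrahedra t -> f \subset s ->
  (f \in triangles t) = (#|f| == 3).
Proof.
move=> ts fs; rewrite inE andb_idl // => /eqP f3.
have [i [j sij]] := tetrahedra_pairs n_ge5 t_incr ts.
apply: (boundary_complex_pairs n_ge5 t_incr (i := i) (j := j)).
  by rewrite -card_gt0 f3.
exact: fintype.subset_trans sij.
Qed.

(** Gale's condition no longer mentions the parameters [t], which makes the rotation invariance of
    the facets purely combinatorial. *)
Lemma tetrahedraE s : (s \in tetrahedra t) =
  (#|s| == 4) && [exists i, exists j, s \subset [set i; ordS i] :|: [set j; ordS j]].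
Proof.
apply/idP/andP => [ts|[s4 /existsP[i /existsP[j sij]]]].
  have [i [j sij]] := tetrahedra_pairs n_ge5 t_incr ts.
  split; first by move: ts; rewrite inE => /andP[].
  by apply/existsP; exists i; apply/existsP; exists j.
rewrite inE s4 andbT; apply: boundary_complex_pairs sij => //.
by rewrite -card_gt0 (eqP s4).
Qed.

Lemma tetrahedra_rot s : (rot s \in tetrahedra t) = (s \in tetrahedra t).
Proof.
rewrite !tetrahedraE card_imset; last exact: ordS_inj.
have rotE i j : [set ordS i; ordS (ordS i)] :|: [set ordS j; ordS (ordS j)] =
    rot ([set i; ordS i] :|: [set j; ordS j]).
  by rewrite !imsetU !imset_set1.
congr (_ && _); apply/existsP/existsP => -[i /existsP[j sij]].
  exists (ord_pred i); apply/existsP; exists (ord_pred j).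
  move: sij; rewrite -{1 2}(ord_predK i) -{1 2}(ord_predK j) rotE.
  by rewrite subset_imset_inj //; exact: ordS_inj.
by exists (ordS i); apply/existsP; exists (ordS j); rewrite rotE imsetS.
Qed.

Lemma length2_ordS i j : length2 l (ordS i) (ordS j) = length2 l i j.
Proof.
rewrite /length2 (inj_eq (@ordS_inj n)); case: eqVneq => // ij.
have [_ lc] := l_cyclic.
rewrite (lc _ _ i j) ?edgesE ?cards2 ?ij ?(inj_eq (@ordS_inj n)) ?ij //.
exact: cycle_dist_ordS.
Qed.

Lemma length_rot e : e \in edges t -> l (rot e) = l e.
Proof.
rewrite edgesE => /cards2P[i [j [ij ->]]].
rewrite imsetU !imset_set1; have [_ lc] := l_cyclic.
by apply: lc; rewrite ?edgesE ?cards2 ?(inj_eq (@ordS_inj n)) ?ij //;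
  exact: cycle_dist_ordS.
Qed.

Lemma tetrahedra_realizable s : s \in tetrahedra t -> exists p, realizes l s p.
Proof. by rewrite inE => /andP[st _]; have [[_ sr] _] := l_cyclic; exact: sr. Qed.

Lemma card_tetrahedra s : s \in tetrahedra t -> #|s| = 4.
Proof. by rewrite inE => /andP[_ /eqP]. Qed.

Lemma rot_realizable s : s \in tetrahedra t -> exists p, realizes l (rot s) p.
Proof. by rewrite -tetrahedra_rot; exact: tetrahedra_realizable. Qed.

Lemma edge_curvature_rot e : e \in edges t ->
  edge_curvature t l (rot e) = edge_curvature t l e.
Proof.
move=> te; rewrite /edge_curvature (length_rot te).
suff -> : \sum_(s in tetrahedra t | rot e \subset s) dihedral_angle l (rot e) s =
    \sum_(s in tetrahedra t | e \subset s) dihedral_angle l e s by [].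
rewrite [LHS](reindex_inj rot_inj); apply: eq_big => [s|s /andP[]].
  by rewrite tetrahedra_rot subset_imset_inj //; exact: ordS_inj.
rewrite tetrahedra_rot subset_imset_inj; last exact: ordS_inj.
move=> ts es; apply: dihedral_angle_relabel => //.
- exact: ordS_inj.
- exact: length2_ordS.
- exact: card_tetrahedra.
- exact: tetrahedra_realizable.
- exact: rot_realizable.
- by apply/eqP; rewrite -edgesE.
Qed.

Lemma sum_edges_rot (F : {set 'I_n} -> R) v :
  (forall e, e \in edges t -> F (rot e) = F e) ->
  \sum_(e in edges t | ordS v \in e) F e = \sum_(e in edges t | v \in e) F e.
Proof.
move=> FE; rewrite (reindex_inj rot_inj); apply: eq_big => [e|e /andP[te _]].
  by rewrite !edgesE card_imset ?mem_imset //; exact: ordS_inj.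
by rewrite FE // edgesE -(card_imset _ (@ordS_inj n)) -edgesE.
Qed.

Lemma ordS_const (F : 'I_n -> R) : (forall v, F (ordS v) = F v) ->
  forall v v', F v = F v'.
Proof.
move=> FS v v'; have n_gt0 : (0 < n)%N by exact: leq_trans n_ge5.
suff F0 k (kn : (k < n)%N) : F (Ordinal kn) = F (Ordinal n_gt0).
  by case: v v' => [k kn] [k' kn']; rewrite !F0.
elim: k kn => [|k IH] kn; first by congr F; apply: val_inj.
rewrite -(IH (ltnW kn)) -[RHS]FS; congr F; apply: val_inj.
by rewrite /= modn_small.
Qed.

Lemma vertex_curvature_const v v' :
  vertex_curvature t l v = vertex_curvature t l v'.
Proof.
apply: ordS_const => {}v; congr (_ * _).
by apply: sum_edges_rot; exact: edge_curvature_rot.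
Qed.

Lemma vertex_length_const v v' : vertex_length t l v = vertex_length t l v'.
Proof.
by apply: ordS_const => {}v; congr (_ * _); apply: sum_edges_rot; exact: length_rot.
Qed.

(** The triangles of a tetrahedron are indexed by their opposite vertices, since [s :\ x] determines
    [x] in [s]. *)
Lemma sum_facets (P : pred {set 'I_n}) (F : {set 'I_n} -> R) s :
  s \in tetrahedra t ->
  \sum_(f in triangles t | P f && (f \subset s)) F f =
    \sum_(x in s | P (s :\ x)) F (s :\ x).
Proof.
move=> ts; have s4 := card_tetrahedra ts.
rewrite [RHS]big_mkcondr /=.
rewrite -(big_imset (fun f => if P f then F f else 0)
  (h := fun x => s :\ x)) /=; last first.
  move=> x y sx _ sxy; apply/eqP/negP => /negP xy.
  by have := setD11 x s; rewrite sxy in_setD1 xy sx.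
rewrite -big_mkcondr; apply: eq_bigl => f /=.
rewrite andbCA [RHS]andbC; congr (_ && _).
apply/andP/imsetP => [[tf fs]|[x sx ->]].
  have : #|s :\: f| == 1
    by rewrite cardsDS // s4; move: tf; rewrite (trianglesE ts fs) => /eqP->.
  move=> /cards1P[x sfx]; have : x \in s :\: f by rewrite sfx set11.
  rewrite finset.in_setD => /andP[_ sx]; exists x => //.
  by rewrite -sfx finset.setDDr finset.setDv finset.set0U; apply/esym/finset.setIidPr.
have fs : s :\ x \subset s by exact: subD1set.
rewrite (trianglesE ts fs) fs; split=> //.
by move: s4; rewrite (cardsD1 x) sx add1n => -[->].
Qed.

Lemma vertex_volumeE v : vertex_volume t l v =
  3^-1 * \sum_(s in tetrahedra t) \sum_(x in s | v \in s :\ x)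
    signed_height l (s :\ x) s * triangle_area l (s :\ x).
Proof.
congr (_ * _); apply: eq_bigr => s ts.
exact: (sum_facets (fun f => v \in f)
  (fun f => signed_height l f s * triangle_area l f)).
Qed.

Lemma vertex_volume_const v v' : vertex_volume t l v = vertex_volume t l v'.
Proof.
apply: ordS_const => {}v; rewrite !vertex_volumeE; congr (_ * _).
rewrite (reindex_inj rot_inj); apply: eq_big => [s|s]; first exact: tetrahedra_rot.
rewrite tetrahedra_rot => ts; rewrite [LHS](reindex_inj (@ordS_inj n)).
have SE x : rot s :\ ordS x = rot (s :\ x).
  by rewrite imsetD_inj ?imset_set1 //; exact: ordS_inj.
apply: eq_big => [x|x /andP[]].
  by rewrite SE !mem_imset //; exact: ordS_inj.
rewrite mem_imset; last exact: ordS_inj.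
move=> sx _; apply: signed_height_area_relabel => //.
- exact: ordS_inj.
- exact: length2_ordS.
- exact: card_tetrahedra.
- exact: tetrahedra_realizable.
- exact: rot_realizable.
Qed.

(** * Totals over the vertices and their positivity *)

Lemma sum_vertex_length : \sum_v vertex_length t l v = total_length t l.
Proof.
rewrite -mulr_sumr; under eq_bigr do rewrite big_mkcondr.
rewrite exchange_big /= mulr_sumr; apply: eq_bigr => e.
rewrite edgesE -big_mkcond sumr_const => /eqP->.
(* Each edge is counted at its two ends, which cancels the factor 1/2. *)
by rewrite -[X in _ * X]mulr_natl mulKf // pnatr_eq0.
Qed.

Lemma sum_signed_height_area s : s \in tetrahedra t ->
  \sum_(x in s) signed_height l (s :\ x) s * triangle_area l (s :\ x) =
    3 * tetra_volume l s.
Proof.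
move=> ts; have s4 := card_tetrahedra ts.
have sr := tetrahedra_realizable ts.
have [x0 sx0] : exists x, x \in s by apply/finset.set0Pn; rewrite -card_gt0 s4.
have [w sw] := exists_circum_weights sr sx0.
under eq_bigr => x sx do rewrite (signed_height_area sr s4 sx sw).
by rewrite -mulr_sumr; case: sw => -> _; rewrite mulr1.
Qed.

Lemma sum_vertex_volume : \sum_v vertex_volume t l v = 3 * total_volume t l.
Proof.
under eq_bigr do rewrite vertex_volumeE.
rewrite -mulr_sumr exchange_big /= mulr_sumr [RHS]mulr_sumr; apply: eq_bigr => s ts.
rewrite -(sum_signed_height_area ts).
under eq_bigr do rewrite big_mkcondr.
rewrite exchange_big /= mulr_sumr; apply: eq_bigr => x sx.
rewrite -big_mkcond sumr_const.
(* Each pair of a tetrahedron and a face is counted at the three vertices of the face, which cancels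
   the factor 1/3. *)
have -> : #|s :\ x| = 3.
  by have := card_tetrahedra ts; rewrite (cardsD1 x) sx add1n => -[].
by rewrite -[X in _ * X]mulr_natl mulKf // pnatr_eq0.
Qed.

Lemma total_length_gt0 : 0 < total_length t l.
Proof.
have [[l_gt0 _] _] := l_cyclic.
have n_gt0 : (0 < n)%N by exact: leq_trans n_ge5.
have n_gt1 : (1 < n)%N by exact: leq_trans n_ge5.
have te : [set Ordinal n_gt0; Ordinal n_gt1] \in edges t.
  by rewrite edgesE cards2.
rewrite /total_length (bigD1 _ te) /= ltr_wpDr ?l_gt0 //.
by apply: sumr_ge0 => e /andP[/l_gt0/ltW].
Qed.

Lemma total_volume_gt0 : 0 < total_volume t l.
Proof.
have vol_gt0 s : s \in tetrahedra t -> 0 < tetra_volume l s.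
  by move=> ts; have [p /tetra_volume_gt0] := tetrahedra_realizable ts;
    apply; exact: card_tetrahedra.
have n_gt0 : (0 < n)%N by exact: leq_trans n_ge5.
have n_gt2 : (2 < n)%N by exact: leq_trans n_ge5.
pose i := Ordinal n_gt0; pose j := Ordinal n_gt2.
(* The indices 0, 1, 2, 3 form a tetrahedron, so the sum of volumes is not empty. *)
have ts : [set i; ordS i] :|: [set j; ordS j] \in tetrahedra t.
  rewrite tetrahedraE; apply/andP; split; last first.
    by apply/existsP; exists i; apply/existsP; exists j.
  have n1 : (1 < n)%N by exact: leq_trans n_ge5.
  have n3 : (3 < n)%N by exact: leq_trans n_ge5.
  by rewrite -finset.setUA !cardsU1 cards1 !inE -!val_eqE /= !modn_small.
rewrite /total_volume (bigD1 _ ts) /= ltr_wpDr ?vol_gt0 //.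
by apply: sumr_ge0 => s /andP[/vol_gt0/ltW].
Qed.

(** Both sums are n times the common value, and a nonzero sum of [X] makes both n and that value
    invertible. *)
Lemma constant_ratio (K X : 'I_n -> R) : (forall v v', K v = K v') ->
  (forall v v', X v = X v') -> \sum_v X v != 0 ->
  forall v, K v = (\sum_v K v) / (\sum_v X v) * X v.
Proof.
move=> Kc Xc X0 v.
have sumE (F : 'I_n -> R) : (forall u u', F u = F u') ->
    \sum_u F u = n%:R * F v.
  move=> Fc; rewrite (eq_bigr (fun=> F v)) => [|u _]; last exact: Fc.
  by rewrite sumr_const card_ord mulr_natl.
rewrite (sumE _ Kc) (sumE _ Xc); move: X0.
rewrite (sumE _ Xc) mulf_eq0 negb_or => /andP[n0 x0].
by field; rewrite n0 x0.
Qed.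

End CyclicMetric.

Theorem theorem5p5 (R : realType) (n : nat) (t : 'I_n -> R)
    (l : {set 'I_n} -> R) (n_ge5 : (5 <= n)%N)
    (t_incr : forall i j : 'I_n, (i < j)%N -> t i < t j)
    (l_cyclic : is_cyclic_length_metric t l) :
  is_LCSC t l /\ is_VCSC t l.
Proof.
have Kc := vertex_curvature_const n_ge5 t_incr l_cyclic.
have Lc := vertex_length_const n_ge5 t_incr l_cyclic.
have Vc := vertex_volume_const n_ge5 t_incr l_cyclic.
split=> v.
  (* [EHR] is by definition the sum of the vertex curvatures, so only the denominator has to be
     rewritten as a sum over vertices. *)
  rewrite -(sum_vertex_length l n_ge5 t_incr); apply: constant_ratio => //.
  by rewrite sum_vertex_length // gt_eqF // total_length_gt0.
rewrite -(sum_vertex_volume n_ge5 t_incr l_cyclic); apply: constant_ratio => //.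
rewrite (sum_vertex_volume n_ge5 t_incr l_cyclic) gt_eqF //.
by rewrite mulr_gt0 // total_volume_gt0.
Qed.
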